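(* Let $m\ge s\ge 1$ be integers, let $n=2^{m+s}-2^m+2^s$, and let $D$ be a Steiner $2$-$(n,2^s,1)$ design with block-by-point incidence matrix $A$. Let $C$ be the binary linear code of length $n$ spanned by the rows of $A$ over $GF(2)$, and let $C^\perp$ be its dual code. Then: (i) The all-one vector $\bar{1}=(1,\ldots,1)$ belongs to $C\cap C^\perp$. (ii) The dual code $C^\perp$ admits majority-logic decoding (using the rows of $A$ as parity checks) that corrects up to $t=2^{m-1}$ errors. (iii) The minimum distance $d^\perp$ of $C^\perp$ is an even number; it equals $2^m+2$ if $D$ contains hyperovals, and $d^\perp\ge 2^m+4$ if $D$ has no hyperovals. (iv) The minimum distance $d$ of $C$ is an even number with $d\le 2^s$. (v) The dimension of $C$, i.e. the $2$-rank $\mathrm{rank}_2 A$ of $A$, satisfies \[ 1+\left\lceil \log_2\Big(\sum_{i=0}^{t}\binom{n-1}{i}\Big)\right\rceil \le \mathrm{rank}_2 A \le n-1-\left\lfloor \log_2\Big(\sum_{i=0}^{d/2-1}\binom{n-1}{i}\Big)\right\rfloor, \] where $t=2^{m-1}$ if $d^\perp=2^m+2$, and $t=d^\perp/2-1$ if $d^\perp\ge 2^m+4$.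
   Context: A Steiner $2$-$(v,k,1)$ design is a pair $\{X,B\}$ of a set $X$ of $v$ points and a collection $B$ of $k$-subsets (blocks) such that every two distinct points lie in exactly one block; each point lies in $r=(v-1)/(k-1)$ blocks (here $r=2^m+1$). The incidence matrix has rows indexed by blocks, columns by points, with entry $1$ iff the block contains the point. An oval of $D$ is a set of points meeting every block in at most two points; a hyperoval of $D$ is an oval of size $r+1$ (equivalently, a set of $r+1$ points meeting every block in $0$ or $2$ points). *)

(* Defs.v *)
From mathcomp Require Import all_boot all_order all_algebra.

Set Implicit Arguments.
Unset Strict Implicit.
Unset Printing Implicit Defensive.

Import GRing.Theory.
Local Open Scope ring_scope.

(* For k >= 2 blocks cannot be repeated, as two points lie on only one block;
   a set of blocks is thus no restriction. *)
Definition steiner2 (v k : nat) (X : finType) (B : {set {set X}}) : Prop :=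
  [/\ #|X| = v,
      (forall b, b \in B -> #|b| = k) &
      (forall x y : X, x != y ->
         exists! b, [/\ b \in B, x \in b & y \in b])].

Definition oval (X : finType) (B : {set {set X}}) (S : {set X}) : Prop :=
  forall b, b \in B -> (#|S :&: b| <= 2)%N.

(* The quotient is exact: it is the number r of blocks through a point. *)
Definition replication (v k : nat) : nat := ((v - 1) %/ (k - 1))%N.

Definition hyperoval (v k : nat) (X : finType) (B : {set {set X}})
    (S : {set X}) : Prop :=
  oval B S /\ #|S| = (replication v k + 1)%N.

(* Row i is the i-th block and column j the j-th point, in enumeration order. *)
Definition incidence (X : finType) (B : {set {set X}}) :
    'M['F_2]_(#|B|, #|X|) :=
  \matrix_(i, j) ((enum_val j : X) \in (enum_val i : {set X}))%:R.

Definition row_code (b n : nat) (A : 'M['F_2]_(b, n)) :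
    {vspace 'rV['F_2]_n} :=
  <<[seq row i A | i : 'I_b]>>%VS.

Definition dual_code (n : nat) (C : {vspace 'rV['F_2]_n}) :
    {vspace 'rV['F_2]_n} :=
  (\bigcap_(c in C) lker (linfun (mulmxr c^T)))%VS.

Lemma dual_codeP (n : nat) (C : {vspace 'rV['F_2]_n}) (u : 'rV['F_2]_n) :
  u \in dual_code C <-> (forall c, c \in C -> \sum_j u 0 j * c 0 j = 0).
Proof.
have dotE (c : 'rV['F_2]_n) : (u *m c^T == 0) = (\sum_j u 0 j * c 0 j == 0).
  have -> : \sum_j u 0 j * c 0 j = (u *m c^T) 0 0.
    by rewrite mxE; apply: eq_bigr => j _; rewrite mxE.
  apply/eqP/eqP => [->|uc0]; first by rewrite mxE.
  by apply/matrixP => i j; rewrite !ord1 uc0 mxE.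
split=> [/subv_bigcapP uC c cC | uC].
  by move: (uC c cC); rewrite -memvE memv_ker lfunE /= dotE => /eqP.
apply/subv_bigcapP => c cC; rewrite -memvE memv_ker lfunE /= dotE.
by apply/eqP/uC.
Qed.

Definition hdist (n : nat) (u v : 'rV['F_2]_n) : nat :=
  #|[set j | u 0 j != v 0 j]|.

Definition weight (n : nat) (u : 'rV['F_2]_n) : nat := hdist u 0.

(* The default value n does not affect the minimum as soon as C <> 0, since
   distances are at most n. *)
Definition min_dist (n : nat) (C : {vspace 'rV['F_2]_n}) : nat :=
  \big[minn/n]_(p : 'rV['F_2]_n * 'rV['F_2]_n |
                  [&& p.1 \in C, p.2 \in C & p.1 != p.2]) hdist p.1 p.2.

(* One-step majority-logic decoding: coordinate j of the received word y is
   flipped iff more than half of the parity checks (rows of H) that involve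
   coordinate j fail on y. *)
Definition checks_on (b n : nat) (H : 'M['F_2]_(b, n)) (j : 'I_n) :
    {set 'I_b} :=
  [set i | H i j != 0].

Definition failed_checks (b n : nat) (H : 'M['F_2]_(b, n))
    (y : 'rV['F_2]_n) : {set 'I_b} :=
  [set i | \sum_j H i j * y 0 j != 0].

Definition majority_decode (b n : nat) (H : 'M['F_2]_(b, n))
    (y : 'rV['F_2]_n) : 'rV['F_2]_n :=
  \row_j (y 0 j +
    (#|checks_on H j| < 2 * #|checks_on H j :&: failed_checks H y|)%N%:R).

Definition corrects (n : nat) (C : {vspace 'rV['F_2]_n})
    (dec : 'rV['F_2]_n -> 'rV['F_2]_n) (t : nat) : Prop :=
  forall c e, c \in C -> (weight e <= t)%N -> dec (c + e) = c.

(* Main.v *)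
(* Every point is on r = 2^m + 1 blocks, an odd number, and blocks have even
   size 2^s, so the all-one vector lies in C and in its dual and both codes have
   only even weights.  A word of the dual is a set S of points meeting every
   block evenly.  Each of the r blocks through a point of S meets S again, hence
   |S| >= r + 1, with equality exactly for the hyperovals.  The r checks through
   a point are orthogonal on it, which gives majority decoding.  The bounds on
   the rank are the Hamming bounds for the two codes punctured at one
   coordinate, where an even minimum distance loses just one. *)

Require Import Defs.
From mathcomp Require Import all_boot all_order all_algebra.
From mathcomp Require Import finfield.

Set Implicit Arguments.
Unset Strict Implicit.
Unset Printing Implicit Defensive.

Import GRing.Theory.
Local Open Scope nat_scope.

(** * Weights and distances of binary words *)

Lemma natr_F2_eq0 (n : nat) : (n%:R == 0 :> 'F_2)%R = ~~ odd n.
Proof. by rewrite -(dvdn_pcharf (pchar_Fp (isT : prime 2))) dvdn2. Qed.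

(** Turns equalities in ['F_2] into equalities of booleans. *)
Lemma F2_natr (a : 'F_2) : a = ((a != 0)%R : nat)%:R%R.
Proof. by case: a => [[|[|//]] lt_a2]; apply/val_inj. Qed.

Lemma weightE (n : nat) (u : 'rV['F_2]_n) : weight u = #|[set j | u 0 j != 0]%R|.
Proof. by apply: eq_card => j; rewrite !inE mxE. Qed.

Lemma hdistE (n : nat) (u v : 'rV['F_2]_n) : hdist u v = weight (u - v)%R.
Proof. by rewrite weightE; apply: eq_card => j; rewrite !inE !mxE subr_eq0. Qed.

Lemma weight_gt0 (n : nat) (u : 'rV['F_2]_n) : (u != 0)%R -> 0 < weight u.
Proof.
move=> u0; rewrite weightE card_gt0; apply: contraNneq u0 => supp0.
apply/eqP/rowP => j; rewrite mxE; apply/eqP; move/setP/(_ j): supp0.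
by rewrite !inE => /negbFE.
Qed.

Lemma weight_max (n : nat) (u : 'rV['F_2]_n) : weight u <= n.
Proof. by rewrite weightE -[leqRHS]card_ord max_card. Qed.

Lemma weightN (n : nat) (u : 'rV['F_2]_n) : weight (- u)%R = weight u.
Proof. by rewrite !weightE; apply: eq_card => j; rewrite !inE !mxE oppr_eq0. Qed.

Lemma weightD (n : nat) (u v : 'rV['F_2]_n) :
  weight (u + v)%R <= weight u + weight v.
Proof.
rewrite !weightE; apply: leq_trans (leq_card_setU _ _).
apply/subset_leq_card/subsetP => j; rewrite !inE mxE -negb_and.
by apply: contraNN => /andP[/eqP-> /eqP->]; rewrite addr0.
Qed.

Lemma natr_weight (n : nat) (u : 'rV['F_2]_n) :
  ((weight u)%:R = \sum_j u 0 j)%R.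
Proof.
rewrite weightE -sum1dep_card natr_sum [LHS]big_mkcond; apply: eq_bigr => j _.
by rewrite [RHS]F2_natr; case: eqP.
Qed.

Lemma weight_col' (n : nat) (j0 : 'I_n) (u : 'rV['F_2]_n) :
  weight u <= (weight (col' j0 u)).+1.
Proof.
rewrite !weightE -(card_imset _ (@lift_inj _ j0)) (cardsD1 j0) -[leqRHS]add1n.
apply: leq_add; first exact: leq_b1.
apply/subset_leq_card/subsetP => j; rewrite !inE => /andP[jj0 uj].
case: (unliftP j0 j) jj0 uj => [j' ->|->]; last by rewrite eqxx.
by move=> _ uj; apply: imset_f; rewrite inE mxE.
Qed.

(** A binary word is determined by its support, so this counts the subsets of at most [t]
    coordinates, one size at a time. *)
Lemma card_weight_ball (n t : nat) :
  #|[set u : 'rV['F_2]_n | weight u <= t]| = \sum_(0 <= i < t.+1) 'C(n, i).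
Proof.
pose supp (u : 'rV['F_2]_n) := [set j | u 0 j != 0]%R.
have supp_inj : injective supp.
  move=> u v /setP uv; apply/rowP => j; move: (uv j); rewrite !inE.
  by move=> eq_uv; rewrite [LHS]F2_natr [RHS]F2_natr eq_uv.
have -> : #|[set u : 'rV['F_2]_n | weight u <= t]|
          = #|[set S : {set 'I_n} | #|S| <= t]|.
  rewrite -(card_imset _ supp_inj); apply: eq_card => S; rewrite inE.
  apply/imsetP/idP => [[u] | St]; first by rewrite inE weightE => ut ->.
  pose u : 'rV['F_2]_n := (\row_j (j \in S)%:R)%R.
  have suppu : supp u = S.
    by apply/setP => j; rewrite inE mxE natr_F2_eq0; case: (j \in S).
  by exists u; rewrite // inE weightE -/(supp u) suppu.
elim: t => [|t IHt].
  rewrite big_nat1 -[in RHS](card_ord n) -card_draws; apply: eq_card => S.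
  by rewrite !inE leqn0.
rewrite big_nat_recr //= -IHt -[in 'C(_, _)](card_ord n) -card_draws.
have disj : [set S : {set 'I_n} | #|S| <= t] :&:
            [set S : {set 'I_n} | #|S| == t.+1] = set0.
  apply/setP => S; rewrite !inE; apply/negP => /andP[le_St /eqP St].
  by rewrite St ltnn in le_St.
rewrite -cardsUI disj cards0 addn0.
by apply: eq_card => S; rewrite !inE leq_eqVlt ltnS orbC.
Qed.

(** * Minimum distance and the Hamming bound *)

Lemma min_dist_le (n : nat) (C : {vspace 'rV['F_2]_n}) (u : 'rV['F_2]_n) :
  u \in C -> (u != 0)%R -> min_dist C <= weight u.
Proof.
move=> uC u0.
apply: (Order.TotalTheory.bigmin_le_cond (j := (u, 0%R)) n (fun p => hdist p.1 p.2)).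
by rewrite /= uC mem0v u0.
Qed.

(** The bound [w <= n] covers the default value of the iterated minimum; differences of codewords
    are codewords, so weights suffice. *)
Lemma min_dist_ge (n w : nat) (C : {vspace 'rV['F_2]_n}) :
    w <= n -> (forall u, u \in C -> (u != 0)%R -> w <= weight u) ->
  w <= min_dist C.
Proof.
move=> wn wC; apply: (big_ind (leq w)) => // [a b wa wb | [u v] /and3P[uC vC uv]].
  by rewrite leq_min wa.
by rewrite /= hdistE; apply: wC; rewrite ?rpredB ?subr_eq0.
Qed.

Lemma min_dist_attained (n : nat) (C : {vspace 'rV['F_2]_n}) (v : 'rV['F_2]_n) :
    v \in C -> (v != 0)%R ->
  exists u, [/\ u \in C, (u != 0)%R & weight u = min_dist C].
Proof.
move=> vC v0; pose P (u : 'rV['F_2]_n) := (u \in C) && (u != 0)%R.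
have Pv : P v by apply/andP.
case: (arg_minnP (@weight n) Pv) => u /andP[uC u0] u_min.
exists u; split=> //; apply/eqP; rewrite eqn_leq min_dist_le // andbT.
by apply: min_dist_ge (weight_max u) _ => w wC w0; apply/u_min/andP.
Qed.

(* The punctured code has minimum distance at least 2 t + 1, so the balls of
   radius t around its words are disjoint. *)
Lemma hamming_bound_punctured (n t : nat) (C : {vspace 'rV['F_2]_n}) :
    0 < n -> t.*2.+2 <= min_dist C ->
  2 ^ \dim C * \sum_(0 <= i < t.+1) 'C(n.-1, i) <= 2 ^ n.-1.
Proof.
move=> n_gt0 tC; pose j0 := Ordinal n_gt0.
have {1}<- : #|'F_2| = 2 by rewrite card_Fp.
rewrite -card_vspace -card_weight_ball.
have -> : 2 ^ n.-1 = #|{: 'rV['F_2]_n.-1}| by rewrite card_mx card_Fp ?mul1n.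
(* [f] adds an error to a punctured codeword; its injectivity on codewords and errors of weight at
   most [t] is the disjointness of the balls. *)
pose f (p : 'rV['F_2]_n * 'rV['F_2]_n.-1) := (col' j0 p.1 + p.2)%R.
rewrite -[X in X * _]cardsE -cardsX -(card_in_imset (f := f)) ?max_card //.
case=> [c e] [c' e']; rewrite !inE /= => /andP[cC et] /andP[c'C e't].
rewrite /f /= => eq_f.
have eq_diff : (col' j0 (c - c') = e' - e)%R.
  apply/eqP; rewrite raddfB /= subr_eq addrAC -subr_eq opprK.
  by apply/eqP; rewrite [RHS]addrC -eq_f.
(* Otherwise [c - c'] has weight at most 2t + 1: 2t from the two errors and 1 from the deleted
   coordinate. *)
have c_c' : c = c'.
  apply/eqP; rewrite -subr_eq0; apply: contraLR tC => cc'0; rewrite -ltnNge.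
  apply: leq_ltn_trans (min_dist_le (rpredB cC c'C) cc'0) _.
  apply: leq_ltn_trans (weight_col' j0 _) _; rewrite eq_diff !ltnS -addnn.
  by apply: leq_trans (weightD _ _) _; rewrite weightN leq_add.
by rewrite -c_c' in eq_f *; congr (_, _); apply: (addrI (col' j0 c)).
Qed.

(** * Row codes, their duals and majority-logic decoding *)

Lemma mem_row_code (b n : nat) (A : 'M['F_2]_(b, n)) (u : 'rV['F_2]_n) :
  (u \in row_code A) = (u <= A)%MS.
Proof.
apply/idP/idP => [uA | /submxP[D ->]].
  have : (row_code A <= limg (linfun (mulmxr A)))%VS.
    apply/span_subvP => v /imageP[i _ ->]; rewrite rowE.
    have -> : (delta_mx 0 i *m A = linfun (mulmxr A) (delta_mx 0 i : 'rV_b))%R.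
      by rewrite lfunE.
    exact/memv_img/memvf.
  by move/subvP/(_ u uA)/memv_imgP => [v _ ->]; rewrite lfunE submxMl.
rewrite mulmx_sum_row; apply: rpred_sum => i _; apply/rpredZ/memv_span.
exact: image_f.
Qed.

Lemma row_code_sub (b b' n : nat) (A : 'M['F_2]_(b, n)) (A' : 'M['F_2]_(b', n)) :
  (A <= A')%MS -> (row_code A <= row_code A')%VS.
Proof.
by move=> AA'; apply/subvP => u; rewrite !mem_row_code => /submx_trans; apply.
Qed.

(** The rows of [A] may be dependent; those of [row_base A] span the same code and form a free
    family of [\rank A] vectors. *)
Lemma dim_row_code (b n : nat) (A : 'M['F_2]_(b, n)) : \dim (row_code A) = \rank A.
Proof.
have -> : row_code A = row_code (row_base A).
  by apply/eqP; rewrite eqEsubv !row_code_sub ?eq_row_base.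
pose rows := [tuple row i (row_base A) | i < \rank A].
have -> : row_code (row_base A) = <<rows>>%VS.
  apply: eq_span => u; apply/imageP/tnthP => [] [i].
    by move=> _ ->; exists i; rewrite tnth_mktuple.
  by rewrite tnth_mktuple => ->; exists i.
rewrite -[RHS](size_tuple rows); apply/eqP; rewrite -[_ == _]/(free rows).
apply/freeP => k sum0 i.
suff : (\row_i k i *m row_base A = 0 *m row_base A)%R.
  by move/(row_free_inj (row_base_free A))/rowP/(_ i); rewrite !mxE.
rewrite mul0mx mulmx_sum_row -[RHS]sum0; apply: eq_bigr => j _.
by rewrite mxE -tnth_nth tnth_mktuple.
Qed.

Lemma mem_dual_row_code (b n : nat) (A : 'M['F_2]_(b, n)) (u : 'rV['F_2]_n) :
  (u \in dual_code (row_code A)) <-> forall i, (\sum_j u 0 j * A i j = 0)%R.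
Proof.
split=> [/dual_codeP uA i | uA].
  have iA : row i A \in row_code A by rewrite mem_row_code row_sub.
  rewrite -[RHS](uA _ iA).
  by apply: eq_bigr => j _; rewrite mxE.
apply/dual_codeP => c; rewrite mem_row_code => /submxP[D ->].
under eq_bigr do rewrite mxE big_distrr.
rewrite exchange_big big1 // => i _.
rewrite -[RHS](mulr0 (D 0%R i)) -[X in _ = (_ * X)%R](uA i) mulr_sumr.
by apply: eq_bigr => j _; rewrite mulrCA.
Qed.

(** Rank-nullity: the kernel of the transpose of [A] has rank [n - \rank A], and its rows are
    orthogonal to those of [A]. *)
Lemma dim_dual_row_code_ge (b n : nat) (A : 'M['F_2]_(b, n)) :
  n - \rank A <= \dim (dual_code (row_code A)).
Proof.
rewrite -mxrank_tr -mxrank_ker -dim_row_code; apply/dimvS/subvP => u.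
rewrite mem_row_code => /sub_kermxP/rowP uA; apply/mem_dual_row_code => i.
have := uA i; rewrite !mxE => uAi; rewrite -[RHS]uAi.
by apply: eq_bigr => j _; rewrite mxE.
Qed.

(* The checks involving j are orthogonal on j: an error in another coordinate
   spoils at most one of them. *)
Lemma majority_decode_corrects (b n t : nat) (H : 'M['F_2]_(b, n)) :
    (forall j, t.*2 < #|checks_on H j|) ->
    (forall j l, l != j -> #|checks_on H j :&: checks_on H l| <= 1) ->
  corrects (dual_code (row_code H)) (majority_decode H) t.
Proof.
move=> H_many H_orth c e /mem_dual_row_code Hc et; apply/rowP => j.
rewrite !mxE.
set flip := (_ < _).
(* A codeword passes every check, so which checks fail depends on the error alone. *)
have failedE : failed_checks H (c + e)%R = [set i | \sum_l H i l * e 0 l != 0]%R.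
  apply/setP => i; rewrite !inE; congr (_ != _).
  transitivity (\sum_l c 0 l * H i l + \sum_l H i l * e 0 l)%R; last first.
    by rewrite Hc add0r.
  rewrite -big_split /=.
  by apply: eq_bigr => l _; rewrite mxE mulrDr [(c 0 l * _)%R]mulrC.
pose E := [set l | e 0 l != 0]%R.
have E_t : #|E| <= t by rewrite -weightE.
(* By orthogonality each erroneous coordinate other than [j] shares at most one check with [j]. *)
have spoiled : #|\bigcup_(l in E :\ j) (checks_on H j :&: checks_on H l)| <= #|E :\ j|.
  rewrite -[leqRHS]sum1_card; apply: (big_ind2 (fun (A : {set 'I_b}) k => #|A| <= k)).
  - by rewrite cards0.
  - move=> A1 k1 A2 k2 Ak1 Ak2; apply: leq_trans (leq_card_setU _ _) _.
    exact: leq_add.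
  - by move=> l; rewrite !inE => /andP[lj _]; apply: H_orth.
have spoiledP i : i \in checks_on H j ->
    (\sum_(l | l != j) H i l * e 0 l != 0)%R ->
    i \in \bigcup_(l in E :\ j) (checks_on H j :&: checks_on H l).
  move=> ij sum_n0.
  have [l lj Hel] : exists2 l, l != j & (H i l * e 0 l != 0)%R.
    apply/exists_inP; apply: contraNT sum_n0; rewrite negb_exists_in.
    move/forall_inP=> Hel0; rewrite big1 // => l /Hel0.
    by rewrite negbK => /eqP.
  move: Hel; rewrite mulf_eq0 negb_or => /andP[Hil el].
  by apply/bigcupP; exists l; rewrite !inE ?lj //; move: ij; rewrite inE => ->.
have Hj1 i : i \in checks_on H j -> H i j = 1%R.
  by rewrite inE [RHS]F2_natr [LHS]F2_natr => ->.
suff -> : (flip%:R = e 0 j :> 'F_2)%R.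
  by rewrite -addrA (addrr_pchar2 (pchar_Fp (isT : prime 2))) addr0.
(* If [j] is correct, every failing check on [j] is spoiled: at most [t] of at least 2t + 1, no
   majority. *)
case: (eqVneq (e 0 j) 0)%R => [ej0 | ejn0].
  suff -> : flip = false by rewrite ej0.
  apply/negbTE; rewrite -leqNgt; apply: leq_trans (ltnW (H_many j)).
  rewrite mul2n leq_double; apply: leq_trans E_t.
  apply: leq_trans (subset_leq_card (subD1set E j)); apply: leq_trans spoiled.
  apply/subset_leq_card/subsetP => i /setIP[ij]; rewrite failedE inE.
  by rewrite (bigD1 j) //= ej0 mulr0 add0r; apply: spoiledP.
have ej1 : e 0%R j = 1%R by rewrite [LHS]F2_natr ejn0.
suff -> : flip = true by rewrite ej1.
(* If [j] is wrong, a check on [j] passes only when another error compensates. As [j] itself is one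
   of the at most [t] errors, fewer than [t] checks pass and the failing ones prevail. *)
have good : #|checks_on H j :\: failed_checks H (c + e)%R| < t.
  have jE : j \in E by rewrite inE.
  apply: leq_trans E_t; rewrite (cardsD1 j E) jE ltnS; apply: leq_trans spoiled.
  apply/subset_leq_card/subsetP => i /setDP[ij]; rewrite failedE inE negbK.
  rewrite (bigD1 j) //= ej1 (Hj1 i ij) mulr1 => /eqP sum0.
  apply: spoiledP => //; apply/eqP => sum0'; move: sum0.
  by rewrite sum0' addr0 => /eqP; rewrite oner_eq0.
rewrite /flip mul2n -addnn -[ltnLHS](cardsID (failed_checks H (c + e)%R)) ltn_add2l.
have := H_many j; rewrite -(cardsID (failed_checks H (c + e)%R)).
apply: contraLR; rewrite -!leqNgt => le_good.
apply: leq_trans (leq_add le_good (leqnn _)) _.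
by rewrite addnn leq_double ltnW.
Qed.

(** * Counting in Steiner systems *)

Definition blocks_on (X : finType) (B : {set {set X}}) (x : X) : {set {set X}} :=
  [set b in B | x \in b].

Lemma sum_mem_card (T : finType) (A : {set T}) (P : pred T) :
  \sum_(y in A) (P y : nat) = #|[set y in A | P y]|.
Proof.
by rewrite -sum1dep_card big_mkcondr; apply: eq_bigr => y _; case: (P y).
Qed.

Lemma card_blocks_on2 (v k : nat) (X : finType) (B : {set {set X}}) (x y : X) :
  steiner2 v k B -> x != y -> #|blocks_on B x :&: blocks_on B y| = 1.
Proof.
move=> hB xy; have [_ _ /(_ x y xy) [b [[bB xb yb] b_uniq]]] := hB.
apply/eqP/cards1P; exists b; apply/setP => b'; rewrite !inE.
apply/idP/eqP => [/andP[/andP[b'B xb'] /andP[_ yb']] | ->]; first exact/esym/b_uniq.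
by rewrite bB xb yb.
Qed.

(** Double counting: each point of [S] other than [x] lies on exactly one block through [x]. *)
Lemma sum_card_blocks_on (v k : nat) (X : finType) (B : {set {set X}})
    (S : {set X}) (x : X) :
    steiner2 v k B ->
  \sum_(b in blocks_on B x) #|(S :\ x) :&: b| = #|S :\ x|.
Proof.
move=> hB; have cardE b : #|(S :\ x) :&: b| = \sum_(y in S :\ x) (y \in b : nat).
  by rewrite sum_mem_card; apply: eq_card => y; rewrite !inE.
rewrite (eq_bigr _ (fun b _ => cardE b)) exchange_big -[RHS]sum1_card.
apply: eq_bigr => y /=; rewrite !inE eq_sym => /andP[xy _].
rewrite sum_mem_card -[RHS](card_blocks_on2 hB xy); apply: eq_card => b.
by rewrite !inE; case: (b \in B).
Qed.

Lemma card_blocks_on (v k : nat) (X : finType) (B : {set {set X}}) (x : X) :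
  steiner2 v k B -> #|blocks_on B x| * k.-1 = v.-1.
Proof.
move=> hB; have [vX kB _] := hB.
rewrite -vX -cardsT (cardsD1 x setT) inE -(sum_card_blocks_on _ _ hB).
rewrite -sum_nat_const; apply: eq_bigr => b; rewrite inE => /andP[/kB <- xb].
by rewrite (cardsD1 x b) xb; apply: eq_card => y; rewrite !inE andbT.
Qed.

(** A block through [x] meets [S] evenly, hence meets [S :\ x] in an odd number of points, at least
    one. Summing over the [r] blocks gives the bound, with equality when every term is 1. *)
Lemma even_set_leqif (v k r : nat) (X : finType) (B : {set {set X}})
    (S : {set X}) (x : X) :
    steiner2 v k B -> #|blocks_on B x| = r ->
    x \in S -> (forall b, b \in B -> ~~ odd #|S :&: b|) ->
  r.+1 <= #|S| ?= iff [forall b in blocks_on B x, #|S :&: b| == 2].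
Proof.
move=> hB hr xS S_even; rewrite (cardsD1 x S) xS add1n.
have -> : [forall b in blocks_on B x, #|S :&: b| == 2]
          = [forall b in blocks_on B x, 1 == #|(S :\ x) :&: b|].
  apply: eq_forallb_in => b; rewrite inE => /andP[_ xb].
  by rewrite (cardsD1 x) !inE xS xb setIDAC eq_sym.
rewrite -(mono_leqif ltnS) -(sum_card_blocks_on _ _ hB) -hr -sum1_card.
apply: leqif_sum => b; rewrite inE => /andP[bB xb]; apply: leqif_eq.
move: (S_even b bB); rewrite (cardsD1 x) !inE xS xb setIDAC /= negbK.
by case: #|_|.
Qed.

(** At a point [x] of [S], the [r] blocks through [x] share out the other [r] points of [S]. An oval
    allows at most one per block and parity forces at least one; either way it is exactly one. *)
Lemma even_set_oval (v k r : nat) (X : finType) (B : {set {set X}}) (S : {set X}) :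
    steiner2 v k B -> (forall x, #|blocks_on B x| = r) -> #|S| = r.+1 ->
  oval B S <-> (forall b, b \in B -> ~~ odd #|S :&: b|).
Proof.
move=> hB hr Sr; split=> [S_oval | S_even] b bB; last first.
  have [-> | [x /setIP[xS xb]]] := set_0Vmem (S :&: b); first by rewrite cards0.
  have [_] := even_set_leqif hB (hr x) xS S_even; rewrite Sr eqxx => /esym/forall_inP.
  by move=> /(_ b); rewrite inE bB xb => /(_ isT) /eqP ->.
have [-> | [x /setIP[xS xb]]] := set_0Vmem (S :&: b); first by rewrite cards0.
have card_x (b' : {set X}) : x \in b' -> #|S :&: b'| = #|(S :\ x) :&: b'|.+1.
  by move=> xb'; rewrite (cardsD1 x) !inE xS xb' setIDAC.
have : \sum_(b in blocks_on B x) #|(S :\ x) :&: b| = \sum_(b in blocks_on B x) 1.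
  rewrite (sum_card_blocks_on _ _ hB) sum1_card hr; apply: succn_inj.
  by rewrite -Sr (cardsD1 x S) xS.
have le1 (b' : {set X}) : b' \in blocks_on B x -> #|(S :\ x) :&: b'| <= 1 ?= iff
    (#|(S :\ x) :&: b'| == 1).
  rewrite inE => /andP[b'B xb']; apply: leqif_eq.
  by rewrite -ltnS -card_x // S_oval.
move/eqP; rewrite (leqif_sum le1) => /forall_inP/(_ b); rewrite inE bB xb.
by rewrite card_x // => /(_ isT) /eqP ->.
Qed.

(** * Point sets as binary words *)

Definition point_support (X : finType) (u : 'rV['F_2]_#|X|) : {set X} :=
  [set x | u 0 (enum_rank x) != 0]%R.

Definition char_vec (X : finType) (S : {set X}) : 'rV['F_2]_#|X| :=
  (\row_j (enum_val j \in S)%:R)%R.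

Lemma char_vecK (X : finType) : cancel (@char_vec X) (@point_support X).
Proof.
move=> S; apply/setP => x; rewrite inE mxE natr_F2_eq0 enum_rankK.
by case: (x \in S).
Qed.

Lemma point_supportK (X : finType) : cancel (@point_support X) (@char_vec X).
Proof. by move=> u; apply/rowP => j; rewrite mxE inE enum_valK -F2_natr. Qed.

Lemma weight_char_vec (X : finType) (S : {set X}) : weight (char_vec S) = #|S|.
Proof.
rewrite weightE -[in RHS](char_vecK S) -[RHS](card_imset _ enum_rank_inj).
apply: eq_card => j; rewrite inE -[j]enum_valK.
by rewrite mem_imset ?inE //; apply: enum_rank_inj.
Qed.

Lemma char_vec_neq0 (X : finType) (S : {set X}) : (char_vec S != 0)%R = (S != set0).
Proof.
rewrite -(inj_eq (can_inj (@point_supportK X))) char_vecK; congr (S != _).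
by apply/setP => x; rewrite !inE mxE eqxx.
Qed.

Lemma char_vecT (X : finType) : char_vec [set: X] = const_mx 1%R.
Proof. by apply/rowP => j; rewrite !mxE inE. Qed.

Lemma sum_char_vec_incidence (X : finType) (B : {set {set X}}) (S : {set X}) i :
  (\sum_j char_vec S 0 j * incidence B i j = (#|S :&: enum_val i|)%:R)%R.
Proof.
rewrite -[X in _ = (X%:R)%R]weight_char_vec natr_weight; apply: eq_bigr => j _.
by rewrite !mxE inE -natrM mulnb.
Qed.

Lemma mem_dual_incidence (X : finType) (B : {set {set X}}) (S : {set X}) :
  (char_vec S \in dual_code (row_code (incidence B))) <->
  (forall b, b \in B -> ~~ odd #|S :&: b|).
Proof.
apply: iff_trans (mem_dual_row_code _ _) _; split=> [S0 b bB | S_even i].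
  by rewrite -natr_F2_eq0 -(enum_rankK_in bB bB) -sum_char_vec_incidence S0.
by rewrite sum_char_vec_incidence; apply/eqP; rewrite natr_F2_eq0 S_even ?enum_valP.
Qed.

Lemma char_vec_block (X : finType) (B : {set {set X}}) (b : {set X}) :
  b \in B -> char_vec b \in row_code (incidence B).
Proof.
move=> bB; rewrite mem_row_code.
have -> : char_vec b = row (enum_rank_in bB b) (incidence B).
  by apply/rowP => j; rewrite !mxE enum_rankK_in.
exact: row_sub.
Qed.

(** Carries counts of blocks over to counts of row indices. *)
Lemma card_checks_on_incidence (X : finType) (B : {set {set X}}) (D : {set {set X}}) :
    D \subset B ->
  #|[set i : 'I_#|B| | enum_val i \in D]| = #|D|.
Proof.
move=> DB; rewrite -(card_imset _ enum_val_inj); apply: eq_card => b.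
apply/imsetP/idP => [[i] | bD]; first by rewrite inE => iD ->.
have bB := subsetP DB b bD.
by exists (enum_rank_in bB b); rewrite ?inE enum_rankK_in.
Qed.

Lemma checks_on_incidence (X : finType) (B : {set {set X}}) j :
  checks_on (incidence B) j =
  [set i : 'I_#|B| | enum_val i \in blocks_on B (enum_val j)].
Proof.
apply/setP => i; rewrite !inE mxE natr_F2_eq0 enum_valP.
by case: (_ \in _).
Qed.

(** Modulo 2, the weight is the inner product with the all-one vector. *)
Lemma even_weight_dual (n : nat) (C : {vspace 'rV['F_2]_n}) (u : 'rV['F_2]_n) :
  const_mx 1%R \in C -> u \in dual_code C -> ~~ odd (weight u).
Proof.
move=> C1 /dual_codeP/(_ _ C1) sum0; rewrite -natr_F2_eq0 natr_weight -[X in _ == X]sum0.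
by apply/eqP/eq_bigr => j _; rewrite mxE mulr1.
Qed.

Lemma even_weight_of_dual1 (n : nat) (C : {vspace 'rV['F_2]_n}) (u : 'rV['F_2]_n) :
  const_mx 1%R \in dual_code C -> u \in C -> ~~ odd (weight u).
Proof.
move=> /dual_codeP C1 /C1 sum0; rewrite -natr_F2_eq0 natr_weight -[X in _ == X]sum0.
by apply/eqP/eq_bigr => j _; rewrite mxE mul1r.
Qed.

(** * The parameters of the design and the five claims *)

Theorem theorem2p2 (m s n : nat) (X : finType) (B : {set {set X}}) :
  1 <= s -> s <= m ->
  n = 2 ^ (m + s) - 2 ^ m + 2 ^ s ->
  steiner2 n (2 ^ s) B ->
  let A := incidence B in
  let C := row_code A in
  let d := min_dist C in
  let dperp := min_dist (dual_code C) in
  let t := if dperp == 2 ^ m + 2 then 2 ^ (m - 1) else dperp %/ 2 - 1 in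
  [/\ (* (i) *)
      (const_mx 1%R \in (C :&: dual_code C)%VS),
      (* (ii) *)
      corrects (dual_code C) (majority_decode A) (2 ^ (m - 1)),
      (* (iii) *)
      [/\ ~~ odd dperp,
          (exists S, hyperoval n (2 ^ s) B S) -> dperp = 2 ^ m + 2
        & ~ (exists S, hyperoval n (2 ^ s) B S) -> 2 ^ m + 4 <= dperp],
      (* (iv) *)
      ~~ odd d /\ d <= 2 ^ s
    & (* (v) *)
      [/\ \dim C = \rank A,
          1 + up_log 2 (\sum_(0 <= i < t.+1) 'C(n - 1, i)) <= \rank A
        & \rank A <= n - 1 -
            trunc_log 2 (\sum_(0 <= i < (d %/ 2 - 1).+1) 'C(n - 1, i))]].
Proof.
move=> s_gt0 le_sm nE hB A C d dperp t.
have [vX kB _] := hB.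
(* This factorization yields r = 2^m + 1 once [(2 ^ s).-1] is cancelled. *)
have pred_nE : n.-1 = (2 ^ m).+1 * (2 ^ s).-1.
  rewrite nE expnD -[X in _ - X]muln1 -mulnBr subn1 mulSn addnC -!subn1.
  by rewrite -addnBAC ?expn_gt0.
have n_gt0 : 0 < n by rewrite nE addn_gt0 expn_gt0 orbT.
have k_gt1 : 0 < (2 ^ s).-1 by rewrite -ltnS prednK ?expn_gt0 // (ltn_exp2l 0).
have hr x : #|blocks_on B x| = (2 ^ m).+1.
  by apply/eqP; rewrite -(eqn_pmul2r k_gt1) (card_blocks_on _ hB) pred_nE.
have repE : replication n (2 ^ s) + 1 = (2 ^ m).+2.
  by rewrite /replication !subn1 pred_nE mulnK // addn1.
have even_2m : odd (2 ^ m) = false.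
  by rewrite oddX orbF -leqn0 leqNgt (leq_trans s_gt0 le_sm).
have [x0 _] : exists x0 : X, x0 \in X by apply/card_gt0P; rewrite vX.
have [b0 b0B] : exists b0, b0 \in B.
  have : 0 < #|blocks_on B x0| by rewrite hr.
  by case/card_gt0P=> b0; rewrite inE => /andP[b0B _]; exists b0.
have one_dual : const_mx 1%R \in dual_code C.
  rewrite -char_vecT; apply/mem_dual_incidence => b bB.
  by rewrite setTI (kB b bB) oddX orbF -leqn0 -ltnNge.
have checksE j : #|checks_on A j| = (2 ^ m).+1.
  rewrite checks_on_incidence card_checks_on_incidence ?hr //.
  by apply/subsetP => b; rewrite inE => /andP[].
(* The sum of all rows: each column contains 2^m + 1 ones, an odd number since m >= 1. *)
have one_C : const_mx 1%R \in C.
  rewrite mem_row_code; apply/submxP; exists (const_mx 1%R); apply/rowP => j.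
  transitivity ((#|checks_on A j|)%:R : 'F_2)%R.
    by rewrite checksE mxE [RHS]F2_natr natr_F2_eq0 /= even_2m.
  rewrite mxE -sum1dep_card natr_sum big_mkcond; apply: eq_bigr => i _.
  by rewrite [RHS]F2_natr !mxE mul1r; case: (_ == _).
have even_dual u : u \in dual_code C -> ~~ odd (weight u) by apply: even_weight_dual.
have one_neq0 : (const_mx 1 != 0 :> 'rV['F_2]_#|X|)%R.
  by rewrite -char_vecT char_vec_neq0 -card_gt0 cardsT vX.
have b0_neq0 : (char_vec b0 != 0)%R.
  by rewrite char_vec_neq0 -card_gt0 (kB b0 b0B) expn_gt0.
have [u [uD u_neq0 wu]] := min_dist_attained one_dual one_neq0.
have [c [cC c_neq0 wc]] := min_dist_attained (char_vec_block b0B) b0_neq0.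
rewrite -/C -/d in wc cC; rewrite -/dperp in wu.
have dperp_even : ~~ odd dperp by rewrite -wu even_dual.
have d_even : ~~ odd d by rewrite -wc (even_weight_of_dual1 one_dual).
pose S := point_support u.
have uE : u = char_vec S by rewrite point_supportK.
have cardS : #|S| = dperp by rewrite -wu uE weight_char_vec.
have S_even : forall b, b \in B -> ~~ odd #|S :&: b|.
  by apply/mem_dual_incidence; rewrite -uE.
have dperp_ge : (2 ^ m).+2 <= dperp.
  have /set0Pn[x xS] : S != set0 by rewrite -char_vec_neq0 -uE.
  by rewrite -cardS; case: (even_set_leqif hB (hr x) xS S_even).
have dperp_oval : (exists S, hyperoval n (2 ^ s) B S) -> dperp = 2 ^ m + 2.
  move=> [S' [S'_oval]]; rewrite repE addn2 => cardS'.
  apply/eqP; rewrite eqn_leq dperp_ge andbT -cardS' -weight_char_vec.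
  apply: min_dist_le; last by rewrite char_vec_neq0 -card_gt0 cardS'.
  exact/mem_dual_incidence/(even_set_oval hB hr cardS').
(* A minimum-weight word of weight 2^m + 2 would have a hyperoval as support, and 2^m + 3 is odd. *)
have dperp_no_oval : ~ (exists S, hyperoval n (2 ^ s) B S) -> 2 ^ m + 4 <= dperp.
  move=> no_oval; have : dperp != (2 ^ m).+2.
    apply/eqP => dperpE; apply: no_oval; exists S; split; last by rewrite repE cardS.
    by apply/(even_set_oval hB hr); rewrite // cardS.
  rewrite eq_sym addn4 ltn_neqAle andbC ltn_neqAle => -> /=.
  rewrite dperp_ge; apply: contraNneq dperp_even => <-.
  by rewrite /= even_2m.
have d_gt0 : 0 < d by rewrite -wc weight_gt0.
have double_half_pred e : 0 < e -> ~~ odd e -> (e %/ 2 - 1).*2.+2 = e.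
  move=> e_gt0 e_even; rewrite divn2 subn1 -doubleS prednK.
    by rewrite -[RHS]odd_double_half (negbTE e_even).
  by rewrite half_gt0; case: e e_gt0 e_even => [|[|]].
have dperp_gt0 : 0 < dperp by apply: leq_trans dperp_ge.
(* Both cases of [t] agree: half of 2^m + 2, minus one, is 2^(m-1). *)
have tE : t = dperp %/ 2 - 1.
  rewrite /t; case: eqP => // ->; rewrite addn2 divn2 /= subn1 /= subn1.
  by rewrite -[in RHS](prednK (leq_trans s_gt0 le_sm)) expnS mul2n doubleK.
have dimC : \dim C = \rank A := dim_row_code A.
have rank_gt0 : 0 < \rank A.
  by rewrite -dimC lt0n dimv_eq0; apply: contraNneq c_neq0 => C0; rewrite -memv0 -C0.
have X_gt0 : 0 < #|X| by rewrite vX.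
split.
- by rewrite memv_cap one_C one_dual.
- apply: majority_decode_corrects => [j | j l lj].
    rewrite checksE -mul2n -expnS subn1 prednK ?ltnSn //.
    exact: leq_trans s_gt0 le_sm.
  rewrite !checks_on_incidence.
  rewrite -(card_blocks_on2 hB (x := enum_val j) (y := enum_val l)).
    rewrite -[leqRHS](card_checks_on_incidence (B := B)).
      by apply/eq_leq/eq_card => i; rewrite !inE.
    by apply/subsetP => b; rewrite !inE => /andP[/andP[]].
  by rewrite (inj_eq enum_val_inj) eq_sym.
- by split.
- split=> //; rewrite -(kB b0 b0B) -weight_char_vec.
  by apply: min_dist_le; rewrite ?char_vec_block.
split=> //.
(* It suffices that the ball has at most 2^(rank - 1) words: the Hamming bound for the dual code, of
   dimension at least n - rank, gives this after cancelling 2^(n - rank). *)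
- rewrite add1n -ltnS -[in leqRHS](prednK rank_gt0) !ltnS; apply: up_log_min => //.
  have : t.*2.+2 <= dperp by rewrite tE double_half_pred.
  move/(hamming_bound_punctured X_gt0); rewrite subn1 -vX => V_le.
  rewrite -(leq_pmul2l (expn_gt0 2 (#|X| - \rank A))) -expnD.
  have -> : #|X| - \rank A + (\rank A).-1 = #|X|.-1.
    by rewrite -!subn1 addnBA // subnK // rank_leq_col.
  apply: leq_trans V_le; rewrite leq_mul2r leq_exp2l // dim_dual_row_code_ge.
  by rewrite orbT.
(* The Hamming bound for [C] itself, with the ball size [V] bounded below by the power of 2 under
   it. *)
- have : (d %/ 2 - 1).*2.+2 <= d by rewrite double_half_pred.
  move/(hamming_bound_punctured X_gt0); rewrite !subn1 -vX dimC => V_le.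
  set V := \sum_(_ <= i < _) _ in V_le *.
  have V_gt0 : 0 < V by rewrite /V big_ltn // bin0.
  rewrite -[leqLHS](addnK (trunc_log 2 V)) leq_sub2r //.
  rewrite -(leq_exp2l _ _ (isT : 1 < 2)) expnD; apply: leq_trans V_le.
  by rewrite leq_mul2l trunc_logP ?orbT.
Qed.
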